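(* Let $b\in L^1_{\mathrm{loc}}(\mathbb{R})$. If there exist a constant $B$ and a positive integer $k$ such that the estimate $$|\{x\in\mathbb{R}:\ |H^k_bf(x)|>t\}|\le\int_{\mathbb{R}}\phi_k\left(\frac{B|f(x)|}{t}\right)dx$$ holds for all $t>0$ and all $f$, then $b\in\mathrm{BMO}(\mathbb{R})$ and $\|b\|_{\mathrm{BMO}(\mathbb{R})}\lesssim B^{1/k}$.
   Context: $|E|$ denotes the Lebesgue measure of a set $E$, $\log^+t=\max(\log t,0)$, and $\phi_k(t)=t(1+\log^+t)^k$ (with $\phi_k(0)=0$). The symbol $b$ is real-valued. The $k$-th order commutator of the Hilbert transform with symbol $b$ is given by $$H^k_bf(x)=\mathrm{p.v.}\int_{\mathbb{R}}\frac{(b(x)-b(y))^k}{x-y}f(y)\,dy .$$ $\mathrm{BMO}(\mathbb{R})$ is the set of $b\in L^1_{\mathrm{loc}}(\mathbb{R})$ with $\|b\|_{\mathrm{BMO}(\mathbb{R})}=\sup_I\frac1{|I|}\int_I|b(x)-b_I|\,dx<\infty$, where the supremum is over all bounded intervals $I$ and $b_I=\frac1{|I|}\int_I b(x)\,dx$. $X\lesssim Y$ means $X\le cY$ with an absolute constant $c$. *)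

(* Defs.v *)
From mathcomp Require Import all_boot all_order all_algebra.
From mathcomp Require Import all_classical all_reals all_analysis.
Set Implicit Arguments.
Unset Strict Implicit.
Unset Printing Implicit Defensive.
Import Order.TTheory GRing.Theory Num.Theory.
Import numFieldNormedType.Exports.
Local Open Scope classical_set_scope.
Local Open Scope ring_scope.

(* [ln 0 = 0] in the library, so [phi k 0 = 0]. *)
Definition phi (R : realType) (k : nat) (t : R) : R :=
  t * (1 + Num.max (ln t) 0) ^+ k.

Definition commutator_integrand (R : realType) (b : R -> R) (k : nat)
    (f : R -> R) (x y : R) : R :=
  (b x - b y) ^+ k / (x - y) * f y.

Definition outside_ball (R : realType) (x e : R) : set R :=
  [set y | e < `|x - y|].

Definition is_commutator (R : realType) (b : R -> R) (k : nat)
    (f : R -> R) (x l : R) : Prop :=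
  (forall e : R, 0 < e ->
     (@lebesgue_measure R).-integrable (outside_ball x e)
       (EFin \o commutator_integrand b k f x)) /\
  \int[@lebesgue_measure R]_(y in outside_ball x e)
     commutator_integrand b k f x y @[e --> 0^'+] --> l.

(* The principal value H^k_b f (x).  It is given the value 0 where it does not
   exist, so such points belong to no level set {|H^k_b f| > t} with t > 0. *)
Definition commutator (R : realType) (b : R -> R) (k : nat) (f : R -> R)
    (x : R) : R :=
  xget 0 [set l | is_commutator b k f x l].

Definition average (R : realType) (b : R -> R) (I : set R) : R :=
  (fine (lebesgue_measure I))^-1 * \int[@lebesgue_measure R]_(x in I) b x.

(* Degenerate intervals, for which averages make no sense, are excluded by
   the condition on the measure. *)
Definition bounded_intervals (R : realType) : set (set R) :=
  [set I : set R | [/\ is_interval I, bounded_set (I : set R^o) & (0 < lebesgue_measure I)%E]].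

(* The library's [iavg g I] is the average of [`|g|] over [I]. *)
Definition bmo_norm (R : realType) (b : R -> R) : \bar R :=
  ereal_sup [set iavg (fun x => b x - average b I) I
            | I in @bounded_intervals R].

Definition in_BMO (R : realType) (b : R -> R) : Prop :=
  locally_integrable setT b /\ (bmo_norm b < +oo)%E.

(* Main.v *)
Require Import Defs.
From mathcomp Require Import all_boot all_order all_algebra.
From mathcomp Require Import all_classical all_reals all_analysis.
From mathcomp Require Import measurable_realfun ring lra.
Import Order.TTheory GRing.Theory Num.Theory.
Import numFieldNormedType.Exports.
Local Open Scope classical_set_scope.
Local Open Scope ring_scope.

(** To bound the oscillation of [b] on an interval of length [h], take a
    neighbouring interval at distance about [h], cut it at an approximate
    median [m] of [b], and test the hypothesis on the indicators of the two
    parts.  Where [b x - m] is large, [b x - b y] has a constant sign and is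
    large for all [y] in one of the parts, so the commutator is at least of
    order [|b x - m|^k].  At the height [t] of order [B] the logarithm in [phi]
    vanishes, hence [|b - m|] exceeds a multiple of [B^(1/k)] only on a small
    proportion of the interval.  By the theorem of John and Strömberg this
    control of the distribution function gives control of the mean
    oscillation. *)

Local Notation mu := (@lebesgue_measure _).
Local Notation itv x h := (`[x%R, (x + h)%R[%classic).

(** * Measure and integral preliminaries *)

Lemma lebesgue_measure_subset (R : realType) (A B : set R) :
  A `<=` B -> (lebesgue_measure A <= lebesgue_measure B)%E.
Proof. by move=> AB; exact: le_mu_ext. Qed.

Lemma lebesgue_measure_itvco (R : realType) (x h : R) : 0 < h ->
  mu (itv x h) = h%:E.
Proof.
move=> h0; rewrite lebesgue_measure_itv/= lte_fin ltrDl h0 -EFinD.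
by congr EFin; ring.
Qed.

(** Monotone convergence, in the form that removes cut-offs: the depth inside an open set, the
    truncation level of [b], and the bound [|b| <= n] on a part of an interval. *)
Lemma ge0_integral_nondecreasing_set_le (R : realType) (F : (set R)^nat)
    (g : R -> R) (C : \bar R) :
  {homo F : n m / (n <= m)%N >-> n `<=` m} -> (forall n, measurable (F n)) ->
  measurable_fun setT g -> (forall x, 0 <= g x) ->
  (forall n, \int[mu]_(x in F n) (g x)%:E <= C)%E ->
  (\int[mu]_(x in \bigcup_n F n) (g x)%:E <= C)%E.
Proof.
move=> ndF mF mg g0 FC.
have : (\int[mu ]_(x in F i) (g x)%:E)%E @[i --> \oo] -->
    (\int[mu ]_(x in \bigcup_i F i) (g x)%:E)%E.
  apply: ge0_nondecreasing_set_cvg_integral => //.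
  - by move=> n m nm; apply/subsetPset/ndF.
  - by move=> i; apply/measurable_EFinP; exact: measurable_funS mg.
  - by move=> i x _; rewrite lee_fin.
move=> cv; rewrite -(cvg_lim _ cv)//.
apply: lime_le; first by apply/cvg_ex; eexists; exact: cv.
exact: nearW.
Qed.

(** * A covering argument with stopping intervals *)

(** The complement is open: a point [z] outside [U] with [|y - z| < d] also serves all points close
    to [y]. *)
Lemma measurable_interior_at (R : realType) (U : set R) (d : R) :
  measurable [set y | forall z, `|y - z| < d -> U z].
Proof.
rewrite -[X in measurable X]setCK; apply: measurableC; apply: open_measurable.
rewrite openE => y /= /existsNP[z /not_implyP[yzd nUz]].
exists (d - `|y - z|) => /=; first by rewrite subr_gt0.
move=> w /= yw /(_ z) wU; apply: nUz; apply: wU.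
have -> : w - z = (w - y) + (y - z) by ring.
by rewrite (le_lt_trans (ler_normD _ _))// -ltrBrDr distrC.
Qed.

(** Double the cell until [U], being of finite measure, fills at most half of it. The previous cell
    was more than half full and is half as long, so at least a quarter of the last one is filled. *)
Lemma dyadic_stopping (R : realType) (U : set R) (x d : R) : 0 < d ->
  itv x d `<=` U -> (mu U < +oo)%E ->
  exists2 h, d <= h & [/\
    (mu (U `&` itv x h) <= (h / 2)%:E)%E &
    (h%:E <= 4%:E * mu (U `&` itv x h))%E].
Proof.
move=> d0 dU Uoo.
pose P j := (mu (U `&` itv x (2 ^+ j * d)) <=
             (2 ^+ j * d / 2)%:E)%E.
have exP : exists j, P j.
  have [r Ur] : exists r, (mu U <= r%:E)%E.
    by exists (fine (mu U)); rewrite fineK// ge0_fin_numE.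
  (* As [r] bounds the measure of [U], it suffices that [2 ^+ j * d] exceed [2 * r]. *)
  exists (Num.Def.trunc (r / d * 2)).+1.
  apply: le_trans; first by apply: lebesgue_measure_subset; exact: subIsetl.
  apply: (le_trans Ur); rewrite lee_fin.
  set j := (Num.Def.trunc _).+1.
  have : r / d * 2 < j%:R by exact: truncnS_gt.
  have : (j%:R : R) <= 2 ^+ j by rewrite -natrX ler_nat ltnW// ltn_expl.
  move=> j1 j2; have {j1 j2}: r / d * 2 < 2 ^+ j by exact: lt_le_trans j1.
  by rewrite -ltr_pdivlMr// ltr_pdivrMr// => /ltW; rewrite mulrAC.
(* The minimum is not [0]: the first cell lies in [U], hence is entirely filled. *)
case: (ex_minnP exP) => -[|j] Pj jmin.
  move: Pj; rewrite /P expr0 mul1r setIC setIidl// lebesgue_measure_itvco//.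
  rewrite lee_fin; lra.
have nPj : ~~ P j by apply/negP => /jmin; rewrite ltnn.
have j1 : 1 <= 2 ^+ j :> R by rewrite exprn_ege1// ler1n.
exists (2 ^+ j.+1 * d); first by rewrite exprS; nra.
split; first exact: Pj.
move: nPj; rewrite /P -ltNge => /ltW nPj.
have : ((2 ^+ j * d / 2)%:E <=
   mu (U `&` itv x (2 ^+ j.+1 * d)))%E.
  apply: (le_trans nPj); apply: lebesgue_measure_subset; apply: setIS => y /=.
  rewrite !in_itv/= => /andP[-> /lt_le_trans]; apply.
  rewrite lerD2l exprS; nra.
move=> hj; apply: (@le_trans _ _ (4%:E * (2 ^+ j * d / 2)%:E)%E).
  by rewrite -EFinM lee_fin exprS; lra.
by rewrite lee_pmul2l// lte_fin.
Qed.

(* Scan [a, a + L[ from left to right in steps of [d]: a cell contained in [U] is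
   replaced by the first of its dyadic enlargements that is at most half filled
   by [U], any other cell contains no point at depth [d] inside [U].  This plays
   the role of the Calderon-Zygmund decomposition and needs no differentiation
   theorem. *)
Lemma greedy_cover_le (R : realType) (U : set R) (g : R -> R) (a L M d : R) :
  measurable U -> measurable_fun setT g -> (forall x, 0 <= g x) ->
  0 <= M -> 0 < d -> (mu U <= (L / 8)%:E)%E ->
  (forall x h, a <= x -> 0 < h -> x + h <= a + 2 * L ->
    (mu (U `&` itv x h) <= (h / 2)%:E)%E ->
    (\int[mu]_(y in itv x h) (g y)%:E <= (M * h)%:E)%E) ->
  (\int[mu]_(y in [set y | forall z, (`|y - z| < d)%R -> U z] `&` itv a L) (g y)%:E
    <= (4 * M)%:E * mu U)%E.
Proof.
move=> mU mg g0 M0 d0 UL gM; set K := [set y | _].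
have mK : measurable K by exact: measurable_interior_at.
have Uoo : (mu U < +oo)%E by rewrite (le_lt_trans UL)// ltry.
have Ufin A : measurable A -> mu (U `&` A) \is a fin_num.
  move=> mA; rewrite ge0_fin_numE//; apply: le_lt_trans Uoo.
  by apply: lebesgue_measure_subset; exact: subIsetl.
have mg' A : measurable A -> measurable_fun A (EFin \o g).
  by move=> mA; apply/measurable_EFinP; exact: measurable_funS mg.
(* Induction on the number of steps left. Only the part of [U] to the right of [x] is charged, so
   successive stopping intervals are charged to disjoint pieces of [U]. *)
suff main n x : a <= x -> a + L - x <= n%:R * d ->
    (\int[mu]_(y in K `&` `[x, (a + L)%R[) (g y)%:E
      <= (4 * M)%:E * mu (U `&` `[x, +oo[))%E.
  apply: (le_trans (main (Num.Def.trunc (L / d)).+1 a _ _)) => //.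
    by rewrite addrAC subrr add0r -ler_pdivrMr// ltW// truncnS_gt.
  apply: lee_wpmul2l; first by rewrite lee_fin mulr_ge0.
  by apply: lebesgue_measure_subset; exact: subIsetl.
elim: n x => [|n IH] x ax xn.
  rewrite [X in (\int[_]_(_ in X) _)%E](_ : _ = set0).
    by rewrite integral_set0 mule_ge0// lee_fin mulr_ge0.
  by apply/seteqP; split => y //= [_]; rewrite in_itv/=; lra.
have [xL|Lx] := ltP x (a + L); last first.
  rewrite [X in (\int[_]_(_ in X) _)%E](_ : _ = set0).
    by rewrite integral_set0 mule_ge0// lee_fin mulr_ge0.
  by apply/seteqP; split => y //= [_]; rewrite in_itv/=; lra.
have [xdU|xdU] := pselect (itv x d `<=` U); last first.
  have {}IH := IH (x + d).
  (* A point of [K] in [[x, x + d[] would force this whole cell into [U], so the cell contributes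
     nothing. *)
  rewrite [X in (\int[_]_(_ in X) _)%E](_ : _ = K `&` `[x + d, a + L[).
    apply: (le_trans (IH _ _)); first by lra.
      by move: xn; rewrite -natr1; lra.
    apply: lee_wpmul2l; first by rewrite lee_fin mulr_ge0.
    apply: lebesgue_measure_subset; apply: setIS => y /=.
    by rewrite !in_itv/=; lra.
  apply/seteqP; split => y /= [Ky]; rewrite !in_itv/= => yx; split => //; last first.
    by lra.
  have [|dy] := ltP y (x + d); last by lra.
  move=> yd; exfalso; apply: xdU => z /=; rewrite in_itv/= => xz; apply: Ky.
  by rewrite ltr_norml; lra.
have [h dh [Uh hU]] := dyadic_stopping _ _ _ _ d0 xdU Uoo.
have h0 : 0 < h by lra.
(* Together with [x < a + L] this keeps the stopping interval below [a + 2 * L], where [gM]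
   applies. *)
have hL : h <= L / 2.
  rewrite -lee_fin; apply: (le_trans hU).
  apply: (@le_trans _ _ (4%:E * (L / 8)%:E)%E).
    rewrite lee_pmul2l// ?lte_fin//; apply: le_trans UL.
    by apply: lebesgue_measure_subset; exact: subIsetl.
  by rewrite -EFinM lee_fin; lra.
have gh : (\int[mu]_(y in itv x h) (g y)%:E <= (M * h)%:E)%E by apply: gM => //; lra.
have {}IH : (\int[mu]_(y in K `&` `[(x + h)%R, (a + L)%R[) (g y)%:E
      <= (4 * M)%:E * mu (U `&` `[(x + h)%R, +oo[))%E.
  by apply: IH; [lra|move: xn; rewrite -natr1; lra].
rewrite [X in mu X](_ : _ = (U `&` itv x h) `|` (U `&` `[x + h, +oo[)); last first.
  rewrite -setIUr; congr (_ `&` _); apply/seteqP; split => y /=; rewrite !in_itv/= ?andbT.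
    by move=> xy; have [|] := ltP y (x + h); [left|right]; rewrite ?andbT; lra.
  by case; lra.
rewrite measureU//=; [|exact: measurableI|exact: measurableI|]; last first.
  by apply/seteqP; split => y //= [[_] + [_]]; rewrite !in_itv/=; lra.
rewrite muleDr//; last by rewrite ge0_adde_def// inE.
apply: (@le_trans _ _ (\int[mu]_
    (y in itv x h `|` (K `&` `[(x + h)%R, (a + L)%R[)) (g y)%:E)%E).
  apply: ge0_subset_integral => //.
  - exact: measurableI.
  - by apply: measurableU => //; exact: measurableI.
  - by apply: mg'; apply: measurableU => //; exact: measurableI.
  - by move=> y _; rewrite lee_fin.
  move=> y /= [Ky]; rewrite !in_itv/= => yx.
  by have [|] := ltP y (x + h); [left|right; split => //]; lra.
rewrite ge0_integral_setU//=.
- apply: leeD => //; apply: (le_trans gh).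
  rewrite EFinM [(4 * M)%R]mulrC EFinM -muleA; apply: lee_wpmul2l => //.
- exact: measurableI.
- by apply: mg'; apply: measurableU => //; exact: measurableI.
- by move=> y _; rewrite lee_fin.
- rewrite disj_set2E; apply/eqP/seteqP; split => y //= [+ [_]].
  by rewrite !in_itv/=; lra.
Qed.

(** The bound of the greedy scan does not depend on [d], and an open set is the increasing union of
    its parts at depth [1 / (n + 1)]. *)
Lemma open_cover_le (R : realType) (U : set R) (g : R -> R) (a L M : R) :
  open U -> measurable_fun setT g -> (forall x, 0 <= g x) ->
  0 <= M -> (mu U <= (L / 8)%:E)%E ->
  (forall x h, a <= x -> 0 < h -> x + h <= a + 2 * L ->
    (mu (U `&` itv x h) <= (h / 2)%:E)%E ->
    (\int[mu]_(y in itv x h) (g y)%:E <= (M * h)%:E)%E) ->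
  (\int[mu]_(y in U `&` itv a L) (g y)%:E <= (4 * M)%:E * mu U)%E.
Proof.
move=> oU mg g0 M0 UL gM.
pose K n : set R := [set y | forall z, `|y - z| < n.+1%:R^-1 -> U z].
rewrite [X in (\int[_]_(_ in X) _)%E](_ : _ = \bigcup_n (K n `&` itv a L)).
  apply: ge0_integral_nondecreasing_set_le => //.
  - move=> n p np; apply: setSI => y Ky z yz; apply: Ky.
    by apply: (lt_le_trans yz); rewrite lef_pV2 ?posrE// ler_nat.
  - by move=> n; apply: measurableI => //; exact: measurable_interior_at.
  - move=> n; apply: greedy_cover_le => //; exact: open_measurable.
rewrite -setI_bigcupl; congr (_ `&` _); apply/seteqP; split => [y Uy|y [n _]]; last first.
  by apply; rewrite subrr normr0.
have /nbhs_ballP[e /= e0 eU] := open_nbhs_nbhs (conj oU Uy).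
exists (Num.Def.trunc e^-1) => //= z yz; apply: eU => /=.
apply: (lt_trans yz); rewrite invf_plt ?posrE//; exact: truncnS_gt.
Qed.

(** * Points outside exceptional sets, and measurability of level sets *)

(** Otherwise [A] and [B] would cover an interval longer than their total mass in it. Such a point
    [y] allows two reference values to be compared through [b y]. *)
Lemma exists_avoiding (R : realType) (A B : set R) (x h u v : R) : 0 < h ->
  measurable A -> measurable B ->
  (mu (itv x h `&` A) <= u%:E)%E -> (mu (itv x h `&` B) <= v%:E)%E ->
  u + v < h -> exists y, [/\ itv x h y, ~ A y & ~ B y].
Proof.
move=> h0 mA mB Au Bv uvh; apply: contrapT => /forallNP no.
suff : (h%:E <= (u + v)%:E)%E by rewrite lee_fin leNgt uvh.
rewrite -(lebesgue_measure_itvco _ x _ h0).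
apply: (@le_trans _ _ (mu ((itv x h `&` A) `|` (itv x h `&` B)))).
  apply: lebesgue_measure_subset => y yh; apply: contrapT => /not_orP[nA nB].
  by apply: (no y); split => // ?; [apply: nA|apply: nB].
apply: (@le_trans _ _ (mu (itv x h `&` A) + mu (itv x h `&` B))%E).
  by apply: measureU2; exact: measurableI.
by rewrite EFinD; apply: leeD.
Qed.

Lemma measurable_preimage_itv (R : realType) (b : R -> R) (i : interval R) :
  measurable_fun setT b -> measurable [set y | b y \in i].
Proof. by move=> /(_ measurableT _ (measurable_itv i)); rewrite setTI. Qed.

Lemma measurable_lt_cst (R : realType) (b : R -> R) (m : R) :
  measurable_fun setT b -> measurable [set y | b y < m].
Proof.
move=> mb; have := measurable_preimage_itv _ _ `]-oo, m[ mb.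
by under eq_set do rewrite in_itv/= ?andbT.
Qed.

Lemma measurable_cst_lt (R : realType) (b : R -> R) (m : R) :
  measurable_fun setT b -> measurable [set y | m < b y].
Proof.
move=> mb; have := measurable_preimage_itv _ _ `]m, +oo[ mb.
by under eq_set do rewrite in_itv/= ?andbT.
Qed.

Lemma measurable_cst_le (R : realType) (b : R -> R) (m : R) :
  measurable_fun setT b -> measurable [set y | m <= b y].
Proof.
move=> mb; have := measurable_preimage_itv _ _ `[m, +oo[ mb.
by under eq_set do rewrite in_itv/= ?andbT.
Qed.

Lemma measurable_dist (R : realType) (b : R -> R) (m : R) (D : set R) :
  measurable_fun setT b -> measurable_fun D (fun y => `|b y - m|).
Proof.
move=> mb; apply: (@measurable_funS _ _ _ _ setT) => //.
by apply: measurableT_comp => //; exact: measurable_funB.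
Qed.

Lemma measurable_far (R : realType) (b : R -> R) (m s : R) :
  measurable_fun setT b -> measurable [set y | s < `|b y - m|].
Proof.
by move=> mb; apply: (measurable_cst_lt _ (fun y => `|b y - m|)); exact: measurable_dist.
Qed.

(** * The theorem of John and Strömberg *)

Lemma integral_dist_shift (R : realType) (b : R -> R) (m m' x h C D : R) :
  measurable_fun setT b -> 0 < h -> `|m - m'| <= D ->
  (\int[mu]_(y in itv x h) (`|b y - m|%R)%:E <= (C * h)%:E)%E ->
  (\int[mu]_(y in itv x h) (`|b y - m'|%R)%:E <= ((C + D) * h)%:E)%E.
Proof.
move=> mb h0 mD bC; have D0 : 0 <= D by exact: le_trans mD.
apply: (@le_trans _ _ (\int[mu]_(y in itv x h) ((`|b y - m|%R)%:E + D%:E))%E).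
  apply: ge0_le_integral => //=.
  - by apply/measurable_EFinP; exact: measurable_dist.
  - apply/measurable_EFinP; apply: measurable_funD => //; exact: measurable_dist.
  - move=> y _; rewrite lee_fin.
    have -> : b y - m' = (b y - m) + (m - m') by ring.
    by rewrite (le_trans (ler_normD _ _))// lerD2l.
rewrite ge0_integralD//=; last by apply/measurable_EFinP; exact: measurable_dist.
rewrite integral_cst//= [X in (_ * X)%E](_ : _ = h%:E);
  last exact: lebesgue_measure_itvco.
by rewrite mulrDl EFinD; exact: leeD.
Qed.

(* The truncations of [b] have a finite bound [X] to start from, and the affine
   map [X |-> 4 s + X / 2] contracts to [8 s]. *)
Lemma oscillation_step (R : realType) (b : R -> R) (m : R -> R -> R) (s X : R) :
  measurable_fun setT b -> 0 <= s -> 0 <= X ->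
  (forall x h, 0 < h ->
    (mu (itv x h `&` [set y | (s < `|b y - m x h|)%R]) <= (h / 24)%:E)%E) ->
  (forall x h, 0 < h ->
    (\int[mu]_(y in itv x h) (`|b y - m x h|%R)%:E <= (X * h)%:E)%E) ->
  forall x h, 0 < h ->
    (\int[mu]_(y in itv x h) (`|b y - m x h|%R)%:E <= ((4 * s + X / 2) * h)%:E)%E.
Proof.
(* The reference value belongs to the doubled interval because stopping intervals may run past
   [a + L]. *)
move=> mb s0 X0 mw mi a L L0; set m' := m a (2 * L).
have L20 : 0 < 2 * L by lra.
pose E := [set y | s < `|b y - m'|]; have mE : measurable E by exact: measurable_far.
have EL : (mu (itv a (2 * L) `&` E) <= (L / 12)%:E)%E.
  by apply: le_trans (mw a _ L20) _; rewrite lee_fin; lra.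
have mE' : measurable (itv a (2 * L) `&` E) by exact: measurableI.
(* The excess [L / 24] over the mass [L / 12] gives the [L / 8] allowed by the covering. *)
have [||U [oU EU UE]] := @lebesgue_regularity_outer R _ (L / 24) mE'.
- by rewrite (le_lt_trans EL)// ltry.
- lra.
have mU : measurable U by exact: open_measurable.
have UL : (mu U <= (L / 8)%:E)%E.
  pose F := itv a (2 * L) `&` E.
  have -> : mu U = (mu (U `\` F) + mu (U `&` F))%E by exact: measureDI.
  rewrite (_ : L / 8 = L / 24 + L / 12); last by lra.
  rewrite EFinD; apply: leeD; first exact: ltW.
  by apply: le_trans EL; apply: lebesgue_measure_subset; exact: subIsetr.
(* Since [1/2 + 1/24 < 1], some [y] in the interval avoids both exceptional sets, and [b y] is
   within [s] of both [m x h] and [m']. *)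
have near x h : 0 < h -> a <= x -> x + h <= a + 2 * L ->
    (mu (itv x h `&` U) <= (h / 2)%:E)%E -> `|m x h - m'| <= 2 * s.
  move=> h0 ax xh xU.
  have [||y [yh nU /= /negP]] :=
    exists_avoiding _ U [set y | s < `|b y - m x h|] x h _ _ h0 mU _ xU (mw x h h0).
  - exact: measurable_far.
  - lra.
  rewrite -leNgt => bm.
  have : `|b y - m'| <= s.
    rewrite leNgt; apply/negP => sy; apply: nU; apply: EU; split => //.
    by move: yh; rewrite /= !in_itv/=; lra.
  move: bm; rewrite !ler_norml; lra.
have mm' : `|m' - m a L| <= 2 * s.
  have [|||y [yL /= /negP nE /negP]] :=
    exists_avoiding _ E [set y | s < `|b y - m a L|]
      a L (L / 12) _ L0 mE _ _ (mw a L L0).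
  - exact: measurable_far.
  - apply: le_trans EL; apply: lebesgue_measure_subset; apply: setSI => y /=.
    by rewrite !in_itv/=; lra.
  - lra.
  move: nE; rewrite -!leNgt !ler_norml; lra.
(* Per unit length, passing from [m'] to [m a L] costs [2 * s], the part in [U] costs
   [4 * (X + 2 * s) / 8], and the part outside [U] costs [s]. *)
rewrite (_ : 4 * s + X / 2 = (2 * s + X / 2) + 2 * s); last by ring.
apply: (integral_dist_shift _ _ m') => //.
have mg D : measurable D -> measurable_fun D (fun y => (`|b y - m'|%R)%:E).
  by move=> mD; apply/measurable_EFinP; exact: measurable_dist.
rewrite -(setUIDK (itv a L) U) ge0_integral_setU//=; last 4 first.
- exact: measurableI.
- exact: measurableD.
- by rewrite setUIDK; exact: mg.
- by rewrite disj_set2E; apply/eqP/seteqP; split => y //= [[_ ?] [_]].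
have -> : (2 * s + X / 2) * L = (X / 2 + s) * L + s * L by ring.
rewrite EFinD; apply: leeD.
  rewrite setIC; apply: (@le_trans _ _ ((4 * (X + 2 * s))%:E * mu U)%E).
    apply: open_cover_le => //; first exact: measurable_dist.
    - lra.
    - move=> x h ax h0 xh xU; apply: (integral_dist_shift _ _ (m x h)) => //.
      by apply: near => //; rewrite setIC.
      exact: mi.
  apply: (@le_trans _ _ ((4 * (X + 2 * s))%:E * (L / 8)%:E)%E).
    by apply: lee_wpmul2l => //; rewrite lee_fin; lra.
  by rewrite -EFinM lee_fin; lra.
apply: (@le_trans _ _ (\int[mu]_(y in itv a L `\` U) (cst s%:E) y)%E).
  apply: ge0_le_integral => //=.
  - exact: measurableD.
  - by apply: mg; exact: measurableD.
  - move=> y [/= yL nU]; rewrite lee_fin leNgt; apply/negP => sy; apply: nU.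
    by apply: EU; split => //; move: yL; rewrite /= !in_itv/=; lra.
rewrite integral_cst; last exact: measurableD.
rewrite EFinM; apply: lee_wpmul2l => //.
rewrite -(lebesgue_measure_itvco _ a _ L0); apply: lebesgue_measure_subset.
exact: subDsetl.
Qed.

Lemma le_of_geometric_error (R : realType) (u v w : R) :
  (forall n, u <= v + w / 2 ^+ n) -> u <= v.
Proof.
move=> uvw; rewrite leNgt; apply/negP => vu.
have uv0 : 0 < u - v by rewrite subr_gt0.
set n := (Num.Def.trunc (w / (u - v))).+1.
have /(_ n) := uvw; rewrite -lerBlDl leNgt => /negP; apply.
rewrite ltr_pdivrMr ?exprn_gt0// -ltr_pdivrMl// mulrC.
apply: (lt_le_trans (truncnS_gt _)).
by rewrite -natrX ler_nat ltnW// ltn_expl.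
Qed.

(** The crude bound [2 * N] starts the iteration; each step fixes [8 * s] and halves the error. The
    final bound is free of [N], which lets truncations be removed later. *)
Lemma oscillation_bounded (R : realType) (b : R -> R) (m : R -> R -> R) (s N : R) :
  measurable_fun setT b -> 0 <= s ->
  (forall y, `|b y| <= N) -> (forall x h, `|m x h| <= N) ->
  (forall x h, 0 < h ->
    (mu (itv x h `&` [set y | (s < `|b y - m x h|)%R]) <= (h / 24)%:E)%E) ->
  forall x h, 0 < h ->
    (\int[mu]_(y in itv x h) (`|b y - m x h|%R)%:E <= (8 * s * h)%:E)%E.
Proof.
move=> mb s0 bN mN mw.
have N0 : 0 <= N by exact: le_trans (bN 0).
have geo n x h : 0 < h ->
    (\int[mu]_(y in itv x h) (`|b y - m x h|%R)%:E <= ((8 * s + 2 * N / 2 ^+ n) * h)%:E)%E.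
  elim: n x h => [|n IH] x h h0.
    apply: (@le_trans _ _ (\int[mu]_(y in itv x h) (cst (2 * N)%:E) y)%E).
      apply: ge0_le_integral => //=.
      - by apply/measurable_EFinP; exact: measurable_dist.
      - move=> y _; rewrite lee_fin (le_trans (ler_normB _ _))//.
        by have := bN y; have := mN x h; lra.
    rewrite integral_cst//= [X in (_ * X)%E](_ : _ = h%:E);
  last exact: lebesgue_measure_itvco.
    rewrite -EFinM lee_fin expr0; nra.
  have p0 : 0 < 2 ^+ n :> R by rewrite exprn_gt0.
  have X0 : 0 <= 8 * s + 2 * N / 2 ^+ n.
    by rewrite addr_ge0// ?mulr_ge0// invr_ge0 ltW.
  apply: le_trans (oscillation_step _ _ _ _ _ mb s0 X0 mw IH _ _ h0) _.
  rewrite lee_fin exprS invfM ler_pM2r//; lra.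
move=> x h h0.
have fin : (\int[mu]_(y in itv x h) (`|b y - m x h|%R)%:E)%E \is a fin_num.
  rewrite ge0_fin_numE; last by apply: integral_ge0 => y _; rewrite lee_fin.
  by rewrite (le_lt_trans (geo 0%N x h h0))// ltry.
rewrite -(fineK fin) lee_fin.
apply: (le_of_geometric_error _ _ _ (2 * N * h)) => n.
by rewrite -lee_fin fineK// (le_trans (geo n x h h0))// lee_fin; lra.
Qed.

Definition clamp {R : realType} (N y : R) : R := Num.max (- N) (Num.min N y).

Lemma clamp_lipschitz (R : realType) (N u v : R) :
  `|clamp N u - clamp N v| <= `|u - v|.
Proof.
rewrite /clamp /Num.max /Num.min.
by do ![case: ifPn]; rewrite -?leNgt => *; rewrite ler_norml;
  have := ler_norm (u - v); have := ler_norm (v - u); rewrite (distrC v); lra.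
Qed.

Lemma norm_clamp {R : realType} (N u : R) : 0 <= N -> `|clamp N u| <= N.
Proof.
rewrite /clamp /Num.max /Num.min => N0.
by do ![case: ifPn]; rewrite -?leNgt => *; rewrite ler_norml; lra.
Qed.

Lemma clamp_id (R : realType) (N u : R) : `|u| <= N -> clamp N u = u.
Proof.
rewrite /clamp /Num.max /Num.min ler_norml.
by do ![case: ifPn]; rewrite -?leNgt => *; lra.
Qed.

(** Truncation is 1-Lipschitz, so the hypothesis passes to the truncations of [b] and [m]; their
    common bound then passes to the limit. *)
Lemma john_stromberg (R : realType) (b : R -> R) (m : R -> R -> R) (s : R) :
  measurable_fun setT b -> 0 <= s ->
  (forall x h, 0 < h ->
    (mu (itv x h `&` [set y | (s < `|b y - m x h|)%R]) <= (h / 24)%:E)%E) ->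
  forall x h, 0 < h ->
    (\int[mu]_(y in itv x h) (`|b y - m x h|%R)%:E <= (8 * s * h)%:E)%E.
Proof.
move=> mb s0 mw x h h0.
(* This level also dominates [|m x h|], so truncating there changes neither [b] on [F n] nor
   [m x h]. *)
pose F n := itv x h `&` [set y | `|b y| <= n%:R + `|m x h|].
have mF n : measurable (F n).
  apply: measurableI => //; rewrite -[X in measurable X]setTI.
  by apply: measurable_fun_le => //; exact: measurableT_comp.
have -> : itv x h = \bigcup_n F n.
  rewrite -setI_bigcupr; apply/seteqP; split => [y yh|y []//]; split => //.
  exists (Num.Def.trunc `|b y|).+1 => //=.
  by rewrite (le_trans (ltW (truncnS_gt _)))// lerDl.
apply: ge0_integral_nondecreasing_set_le => //.
- move=> n p np; apply: setIS => y /= /le_trans; apply.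
  by rewrite lerD2r ler_nat.
- exact: measurable_dist.
move=> n; set N := n%:R + `|m x h|.
have N0 : 0 <= N by rewrite addr_ge0.
have mcl : measurable_fun setT (fun y => clamp N (b y)).
  by apply: measurable_maxr => //; exact: measurable_minr.
apply: (@le_trans _ _
  (\int[mu]_(y in itv x h) (`|clamp N (b y) - clamp N (m x h)|%R)%:E)%E).
  have -> : (\int[mu]_(y in F n) (`|b y - m x h|%R)%:E =
      \int[mu]_(y in F n) (`|clamp N (b y) - clamp N (m x h)|%R)%:E)%E.
    by apply: eq_integral => y; rewrite inE => -[_ /= bN]; rewrite !clamp_id// lerDr.
  apply: ge0_subset_integral => //; [exact: mF| |exact: subIsetl].
  by apply/measurable_EFinP; exact: measurable_dist.
apply: (oscillation_bounded _ (fun y => clamp N (b y))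
  (fun x h => clamp N (m x h)) s N) => //.
- by move=> y; exact: norm_clamp.
- by move=> ? ?; exact: norm_clamp.
- move=> x' h' h'0; apply: le_trans (mw _ _ h'0); apply: lebesgue_measure_subset.
  by apply: setIS => y /= /lt_le_trans; apply; exact: clamp_lipschitz.
Qed.

(** * From half-open intervals to the BMO norm *)

(** Doubling the length accommodates a right endpoint that may belong to [I]. *)
Lemma bounded_interval_sub_itv (R : realType) (I : set R) : bounded_intervals I ->
  exists a l : R, [/\ 0 < l, mu I = l%:E, measurable I & I `<=` itv a (2 * l)].
Proof.
move=> [/is_intervalP II [r [_ Ir]] I0].
have {}Ir x : I x -> `|x| <= r + 1 by move=> Ix; apply: (Ir (r + 1)) => //; lra.
have lbI : has_lbound I by exists (- (r + 1)) => x /Ir; rewrite ler_norml => /andP[].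
have ubI : has_ubound I by exists (r + 1) => x /Ir; rewrite ler_norml => /andP[].
have mI : measurable I by rewrite II.
have muI : mu I = if inf I < sup I then (sup I - inf I)%:E else 0%E.
  by rewrite {1}II lebesgue_measure_itv /Rhull (asboolT lbI) (asboolT ubI)/= lte_fin.
move: I0; rewrite muI; case: ifPn => [supinf _|_]; last by rewrite ltxx.
exists (inf I), (sup I - inf I); split => //; first by rewrite subr_gt0.
move=> x Ix; rewrite /= in_itv/= (ge_inf lbI Ix)/=.
by have := ub_le_sup ubI Ix; lra.
Qed.

(** The average of [b - m] is at most [C] in absolute value, so replacing [m] by the average of [b]
    costs a further [C]. *)
Lemma iavg_dist_average_le (R : realType) (b : R -> R) (I : set R) (m C l : R) :
  measurable_fun setT b -> measurable I -> mu I = l%:E -> 0 < l ->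
  (\int[mu]_(y in I) (`|b y - m|%R)%:E <= (C * l)%:E)%E ->
  (iavg (fun x => b x - average b I)%R I <= (2 * C)%:E)%E.
Proof.
move=> mb mI Il l0 bC.
have mbm : measurable_fun setT (fun y => b y - m) by exact: measurable_funB.
have ibm : mu.-integrable I (EFin \o (fun y => b y - m)).
  apply/integrableP; split; first by apply/measurable_EFinP; exact: measurable_funS mbm.
  by apply: le_lt_trans bC (ltry _).
have icst : mu.-integrable I (EFin \o (fun=> m)).
  apply: measurable_bounded_integrable => //; first by rewrite [X in (X < _)%E]Il ltry.
  by exists `|m|; split => // M mM x _ /=; exact: ltW.
have avgm : `|m - average b I| <= C.
  rewrite /average Il/=.
  have -> : \int[mu]_(x in I) b x = \int[mu]_(x in I) (b x - m) + m * l.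
    rewrite -[X in _ = _ + m * X]/(fine l%:E) -[in RHS]Il -Rintegral_cst// -RintegralD//.
    by apply: eq_Rintegral => x _; rewrite subrK.
  have -> : m - l^-1 * (\int[mu]_(x in I) (b x - m) + m * l) =
            - (l^-1 * \int[mu]_(x in I) (b x - m)) by field; rewrite gt_eqF.
  rewrite normrN normrM gtr0_norm ?invr_gt0// ler_pdivrMl// mulrC.
  apply: le_trans; first exact: le_normr_Rintegral.
  rewrite /Rintegral.
  rewrite -lee_fin fineK//.
  rewrite ge0_fin_numE; first exact: le_lt_trans bC (ltry _).
  by apply: integral_ge0 => y _; rewrite lee_fin.
rewrite /iavg Il inver gt_eqF// lee_pdivrMl//.
have mg : measurable_fun I (fun y => (`|b y - m|%R)%:E).
  by apply/measurable_EFinP; exact: measurable_dist.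
apply: (@le_trans _ _ (\int[mu]_(y in I) ((`|b y - m|%R)%:E + C%:E))%E).
  apply: ge0_le_integral => //=.
  - by apply/measurable_EFinP; exact: measurable_dist.
  - by apply: emeasurable_funD.
  - move=> y _; rewrite lee_fin.
    have -> : b y - average b I = (b y - m) + (m - average b I) by ring.
    by rewrite (le_trans (ler_normD _ _))// lerD2l.
have C0 : 0 <= C by exact: le_trans avgm.
rewrite ge0_integralD//= integral_cst//= [X in (_ + _ * X)%E]Il.
apply: (@le_trans _ _ ((C * l)%:E + C%:E * l%:E)%E); first exact: leeD.
by rewrite -EFinM -EFinD -EFinM lee_fin; lra.
Qed.

(** The constant is [8 * 2 * 2]: John and Strömberg, the doubled interval, and the passage from [m]
    to the average. *)
Lemma bmo_norm_le (R : realType) (b : R -> R) (m : R -> R -> R) (s : R) :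
  measurable_fun setT b -> 0 <= s ->
  (forall x h, 0 < h ->
    (mu (itv x h `&` [set y | (s < `|b y - m x h|)%R]) <= (h / 24)%:E)%E) ->
  (bmo_norm b <= (32 * s)%:E)%E.
Proof.
move=> mb s0 mw; apply: ge_ereal_sup.
move=> _ [I /bounded_interval_sub_itv[a [l [l0 Il mI Ia]]] <-].
rewrite (_ : 32 * s = 2 * (16 * s)); last by lra.
apply: (iavg_dist_average_le _ _ _ (m a (2 * l)) _ l) => //.
have l20 : 0 < 2 * l by lra.
apply: (@le_trans _ _ (\int[mu]_(y in itv a (2 * l)) (`|b y - m a (2 * l)|%R)%:E)%E).
  apply: ge0_subset_integral => //.
  by apply/measurable_EFinP; exact: measurable_dist.
apply: (le_trans (john_stromberg _ _ _ _ mb s0 mw _ _ l20)).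
by rewrite lee_fin; lra.
Qed.

(** * The commutator of an indicator, away from its support *)

Lemma integrable_separated_kernel (R : realType) (b : R -> R) (k : nat) (E : set R)
    (x h N : R) :
  measurable_fun setT b -> measurable E -> (mu E < +oo)%E -> 0 < h ->
  (forall y, E y -> h <= y - x) -> (forall y, E y -> `|b y| <= N) ->
  mu.-integrable E (EFin \o (fun y => (b x - b y) ^+ k / (x - y))).
Proof.
move=> mb mE Eoo h0 Eh EN; apply: measurable_bounded_integrable => //.
  (* Measurability of the reciprocal comes from that of real powers; the two agree on [E], where
     [y - x > 0]. *)
  apply: (eq_measurable_fun (fun y => (b x - b y) ^+ k * - ((y - x) `^ (-1)))).
    move=> y; rewrite inE => /Eh yx; rewrite powR_inv1; last by lra.
    by rewrite -invrN opprB.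
  apply: (@measurable_funS _ _ _ _ setT) => //.
  apply: measurable_funM; first by apply: measurable_funX; exact: measurable_funB.
  apply: measurableT_comp => //.
  apply: (@measurableT_comp _ _ _ _ _ _ (@powR R ^~ (-1))); first exact: measurable_powR.
  exact: measurable_funB.
exists ((`|b x| + N) ^+ k / h); split => [|M hM y Ey /=]; first exact: num_real.
apply: le_trans (ltW hM); rewrite normrM normrX normfV.
have yx := Eh _ Ey; apply: ler_pM => //.
  apply: lerXn2r; rewrite ?nnegrE//; first by rewrite addr_ge0// (le_trans _ (EN _ Ey)).
  by rewrite (le_trans (ler_normB _ _))// lerD2l EN.
by rewrite distrC ger0_norm ?lef_pV2 ?posrE; lra.
Qed.

(** For [e < h] the truncation at distance [e] leaves all of [E], so the truncated integrals are
    eventually constant and the principal value is an ordinary integral. *)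
Lemma commutator_indic (R : realType) (b : R -> R) (k : nat) (E : set R) (x h N : R) :
  measurable_fun setT b -> measurable E -> (mu E < +oo)%E -> 0 < h ->
  (forall y, E y -> h <= y - x) -> (forall y, E y -> `|b y| <= N) ->
  commutator b k \1_E x = \int[mu]_(y in E) ((b x - b y) ^+ k / (x - y)).
Proof.
move=> mb mE Eoo h0 Eh EN.
have iE := integrable_separated_kernel _ b k E x h N mb mE Eoo h0 Eh EN.
pose q y := (b x - b y) ^+ k / (x - y).
have gq : commutator_integrand b k \1_E x = q \_ E.
  apply/funext => y; rewrite /commutator_integrand patchE indicE.
  by case: ifPn; rewrite ?mulr1 ?mulr0.
have ig : mu.-integrable setT (EFin \o commutator_integrand b k \1_E x).
  rewrite gq (_ : EFin \o (q \_ E) = (EFin \o q) \_ E).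
    by apply: (iffLR (integrable_mkcond _ _) iE).
  by apply/funext => y; rewrite /= !patchE; case: ifPn.
have mO e : measurable (outside_ball x e).
  apply: (measurable_cst_lt _ (fun y => `|x - y|)).
  by apply: measurableT_comp => //; exact: measurable_funB.
have is_l : is_commutator b k \1_E x (\int[mu]_(y in E) q y).
  split; first by move=> e e0; apply: integrableS ig => //; exact: mO.
  apply: (@cvg_trans _ (cst (\int[mu]_(y in E) q y) @ 0^'+)); last exact: cvg_cst.
  apply: near_eq_cvg; near=> e.
  rewrite /= Rintegral_mkcond [RHS]Rintegral_mkcond gq.
  apply: eq_Rintegral => y _; rewrite !patchE.
  have [yE|_] := boolP (y \in E); last by case: ifPn.
  rewrite ifT// inE; move: yE; rewrite inE => /Eh yx.
  rewrite /outside_ball/= distrC ger0_norm; last by lra.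
  by apply: lt_le_trans yx; near: e; exact: nbhs_right_lt.
rewrite /commutator; apply: xget_unique => // l [_ /cvg_lim <- //].
by case: is_l => _ /cvg_lim <-.
Unshelve. all: by end_near. Qed.

(** Multiplied by [- sgn ^+ k], of absolute value 1, the kernel becomes
    [(sgn * (b x - b y)) ^+ k / (y - x)], which is at least [s ^+ k / (3 * h)] on [E]. This treats
    both signs and both parities of [k] at once. *)
Lemma commutator_indic_ge (R : realType) (b : R -> R) (k : nat) (E : set R)
    (x h s sgn N : R) :
  measurable_fun setT b -> measurable E -> (mu E < +oo)%E -> 0 < h -> 0 <= s ->
  `|sgn| = 1 ->
  (forall y, E y -> h <= y - x <= 3 * h) -> (forall y, E y -> `|b y| <= N) ->
  (forall y, E y -> s <= sgn * (b x - b y)) ->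
  s ^+ k / (3 * h) * fine (mu E) <= `|commutator b k \1_E x|.
Proof.
move=> mb mE Eoo h0 s0 sgn1 Eh EN Es.
have Eh1 y : E y -> h <= y - x by move=> /Eh /andP[].
have iE := integrable_separated_kernel _ b k E x h N mb mE Eoo h0 Eh1 EN.
rewrite (commutator_indic _ _ _ _ _ h N)//.
set l := Rintegral _ _ _.
have <- : `|- sgn ^+ k * l| = `|l| by rewrite normrM normrN normrX sgn1 expr1n mul1r.
apply: le_trans (ler_norm _).
rewrite /l -RintegralZl// -Rintegral_cst//.
apply: le_Rintegral => //.
- apply: measurable_bounded_integrable => //.
  by exists `|s ^+ k / (3 * h)|; split => // M hM y _ /=; exact: ltW.
- exact: (integrableZl _ _ iE).
move=> y Ey.
have yx := Eh _ Ey; have sy := Es _ Ey.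
have -> : - sgn ^+ k * ((b x - b y) ^+ k / (x - y)) = (sgn * (b x - b y)) ^+ k / (y - x).
  by rewrite exprMn -[x - y]opprB invrN; ring.
apply: ler_pM.
- exact: exprn_ge0.
- by rewrite invr_ge0; lra.
- by apply: lerXn2r; rewrite ?nnegrE//; lra.
- by rewrite lef_pV2 ?posrE; lra.
Qed.

(** * Approximate medians and the test of the weak-type estimate *)

(** For [B <= t] the logarithm is taken at a point at most 1, so its positive part vanishes and
    [phi] is linear. *)
Lemma phi_indic (R : realType) (k : nat) (B t : R) (E : set R) (y : R) :
  0 <= B -> 0 < t -> B <= t -> phi k (B * `|\1_E y| / t) = B / t * \1_E y.
Proof.
move=> B0 t0 Bt; rewrite indicE; case: (y \in E); last first.
  by rewrite normr0 !mulr0 mul0r /phi mul0r.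
rewrite normr1 !mulr1 /phi max_r ?addr0 ?expr1n ?mulr1//.
by apply: ln_le0; rewrite ler_pdivrMr// mul1r.
Qed.

(* Only quantiles up to [s] are needed, so [m] is searched on a grid of step [s]:
   the least grid point [m + s] below which [b] has mass at least [c]. *)
Lemma exists_grid_quantile (R : realType) (b : R -> R) (J : set R) (N s c : R) :
  measurable_fun setT b -> measurable J -> 0 < s -> 0 < c ->
  (forall y, J y -> `|b y| <= N) -> ((2 * c)%:E <= mu J)%E ->
  exists m, (c%:E <= mu (J `&` [set y | (b y < m + s)%R]))%E /\
            (c%:E <= mu (J `&` [set y | (m <= b y)%R]))%E.
Proof.
move=> mb mJ s0 c0 JN cJ.
pose low j : set R := J `&` [set y | b y < - N + j%:R * s].
have mlow m : measurable (J `&` [set y | b y < m]).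
  by apply: measurableI => //; exact: measurable_lt_cst.
pose P j := (c%:E <= mu (low j))%E.
have exP : exists j, P j.
  exists (Num.Def.trunc (2 * N / s)).+1; rewrite /P /low.
  rewrite setIidl; first by apply: le_trans cJ; rewrite lee_fin; lra.
  move=> y /JN /= yN; have := truncnS_gt (2 * N / s); rewrite ltr_pdivrMr//.
  by have := ler_norm (b y); lra.
(* No value of [b] on [J] lies below [- N], so the least index is positive. *)
case: (ex_minnP exP) => -[|j] Pj jmin.
  move: Pj; rewrite /P (_ : low 0%N = set0) ?measure0 ?lee_fin; first by lra.
  apply/seteqP; split => y //= -[/JN]; rewrite ler_norml /=; lra.
exists (- N + j%:R * s); split.
  by move: Pj; rewrite /P /low -natr1 mulrDl mul1r addrA.
have nPj : ~~ P j by apply/negP => /jmin; rewrite ltnn.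
rewrite leNgt; apply/negP => hi; move: nPj; rewrite -ltNge => lo.
have : (mu J < (2 * c)%:E)%E; last by rewrite ltNge cJ.
have -> : 2 * c = c + c by ring.
rewrite EFinD; apply: le_lt_trans (lteD lo hi).
apply: (@le_trans _ _ (mu (low j `|` (J `&` [set y | (- N + j%:R * s <= b y)%R])))).
  apply: lebesgue_measure_subset => y Jy /=.
  by have [|] := ltP (b y) (- N + j%:R * s); [left|right].
apply: measureU2; first exact: mlow.
by apply: measurableI => //; exact: measurable_cst_le.
Qed.

(** The sets where [|b| <= n] exhaust the interval. Restricting to one of them makes the kernel
    bounded. *)
Lemma exists_bounded_part (R : realType) (b : R -> R) (x h c : R) :
  measurable_fun setT b -> 0 < h -> c < h ->
  exists N, (c%:E <= mu (itv x h `&` [set y | (`|b y| <= N)%R]))%E.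
Proof.
move=> mb h0 ch; apply: contrapT => /forallNP small.
pose F n := itv x h `&` [set y | `|b y| <= n%:R].
have mF n : measurable (F n).
  apply: measurableI => //; rewrite -[X in measurable X]setTI.
  by apply: measurable_fun_le => //; exact: measurableT_comp.
have FT : \bigcup_n F n = itv x h.
  rewrite -setI_bigcupr; apply/seteqP; split => [y []//|y yh]; split => //.
  by exists (Num.Def.trunc `|b y|).+1 => //=; exact/ltW/truncnS_gt.
have int1 A : measurable A -> (\int[mu]_(y in A) (1 : R)%:E)%E = mu A.
  by move=> mA; rewrite integral_cst// mul1e.
have : (h%:E <= c%:E)%E; last by rewrite lee_fin leNgt ch.
rewrite -(lebesgue_measure_itvco _ x _ h0) -FT -int1; last first.
  by apply: bigcup_measurable => n _; exact: mF.
apply: ge0_integral_nondecreasing_set_le => //.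
- by move=> n p np; apply: setIS => y /= /le_trans; apply; rewrite ler_nat.
- move=> n; rewrite int1; last exact: mF.
  by have /negP := small n%:R; rewrite -ltNge => /ltW.
Qed.

Lemma weak_type_indic (R : realType) (b : R -> R) (B t h : R) (k : nat) (E : set R) :
  0 <= B -> 0 < t -> B <= t -> measurable E -> (mu E <= h%:E)%E ->
  (forall f : R -> R, measurable_fun setT f ->
    (mu [set x : R | (t < `|commutator b k f x|)%R]
      <= \int[mu]_x (phi k (B * `|f x| / t))%:E)%E) ->
  (mu [set x : R | (t < `|commutator b k \1_E x|)%R] <= (B / t * h)%:E)%E.
Proof.
move=> B0 t0 Bt mE Eh weak.
have m1 D : measurable_fun D (\1_E : R -> R) by exact: measurable_indic.
apply: (le_trans (weak _ (m1 _))).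
under eq_integral do rewrite phi_indic// EFinM.
have Bt0 : 0 <= B / t by rewrite divr_ge0// ltW.
rewrite ge0_integralZl//=; last by apply/measurable_EFinP; exact: m1.
by rewrite integral_indic// setIT [leRHS]EFinM; apply: lee_wpmul2l.
Qed.

(** On each part of [J] the commutator is at least [s ^+ k / 12 > t], and [B / t * h <= h / 48]
    because [1152 = 24 * 48]. The two signs of [b - m] add up to [h / 24]. *)
Lemma commutator_weak_type_oscillation (R : realType) (b : R -> R) (B s : R) (k : nat) :
  measurable_fun setT b -> 0 <= B -> 0 < s -> 1152 * B <= s ^+ k ->
  (forall (t : R) (f : R -> R), 0 < t -> measurable_fun setT f ->
    (mu [set x : R | (t < `|commutator b k f x|)%R]
      <= \int[mu]_x (phi k (B * `|f x| / t))%:E)%E) ->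
  forall x h, 0 < h -> exists m,
    (mu (itv x h `&` [set y | (2 * s < `|b y - m|)%R]) <= (h / 24)%:E)%E.
Proof.
move=> mb B0 s0 Bs weak x h h0.
have sk0 : 0 < s ^+ k by rewrite exprn_gt0.
pose t := s ^+ k / 24; have t0 : 0 < t by rewrite divr_gt0.
(* The gap [h] between the two intervals puts all distances between [h] and [3 * h]; the mass
   [h / 2] leaves [h / 4] to each part. *)
have [N JN] : exists N, ((2 * (h / 4))%:E <=
    mu (itv (x + 2 * h) h `&` [set y | (`|b y| <= N)%R]))%E.
  by apply: exists_bounded_part => //; lra.
set J := _ `&` _ in JN.
have mJ : measurable J.
  apply: measurableI => //; rewrite -[X in measurable X]setTI.
  by apply: measurable_fun_le => //; exact: measurableT_comp.
have h40 : 0 < h / 4 by lra.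
have JbN y : J y -> `|b y| <= N by case.
have [m [lo hi]] := exists_grid_quantile _ b J N s (h / 4) mb mJ s0 h40 JbN JN.
exists m.
have level E sgn (A : set R) : `|sgn| = 1 -> measurable E -> E `<=` J ->
    ((h / 4)%:E <= mu E)%E ->
    (forall x' y, A x' -> E y -> s <= sgn * (b x' - b y)) ->
    (mu (itv x h `&` A) <= (h / 48)%:E)%E.
  move=> sgn1 mE EJ hE sA.
  have Eh : (mu E <= h%:E)%E.
    rewrite -(lebesgue_measure_itvco _ (x + 2 * h) _ h0).
    by apply: lebesgue_measure_subset => y /EJ[].
  have Eoo : (mu E < +oo)%E by exact: le_lt_trans Eh (ltry _).
  have Bt : B <= t by rewrite /t; lra.
  have := weak_type_indic _ _ _ _ _ _ _ B0 t0 Bt mE Eh (fun f => weak t f t0).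
  move=> level; apply: (@le_trans _ _ (B / t * h)%:E); last first.
    by rewrite lee_fin mulrAC ler_pdivrMr// /t; nra.
  apply: le_trans level; apply: lebesgue_measure_subset => x' [xh Ax] /=.
  have cE : s ^+ k / (3 * h) * fine (mu E) <= `|commutator b k \1_E x'|.
    apply: (commutator_indic_ge _ _ _ _ _ _ _ sgn N) => //.
    - exact: ltW.
    - by move=> y /EJ[/= + _]; move: xh; rewrite /= !in_itv/=; lra.
    - by move=> y /EJ/JbN.
    - by move=> y; exact: sA.
  apply: lt_le_trans cE.
  have hE' : h / 4 <= fine (mu E) by rewrite -lee_fin fineK// ge0_fin_numE.
  apply: (@lt_le_trans _ _ (s ^+ k / (3 * h) * (h / 4))).
    have -> : s ^+ k / (3 * h) * (h / 4) = s ^+ k / 12 by field; rewrite gt_eqF.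
    by rewrite /t; lra.
  by apply: ler_wpM2l => //; rewrite divr_ge0//; lra.
have mgt : measurable (itv x h `&` [set y | m + 2 * s < b y]).
  by apply: measurableI => //; exact: measurable_cst_lt.
have mlt : measurable (itv x h `&` [set y | b y < m - 2 * s]).
  by apply: measurableI => //; exact: measurable_lt_cst.
(* Large values are tested against [b < m + s], small ones against [m <= b]; the threshold [2 * s]
   absorbs the grid step. *)
apply: (@le_trans _ _ (mu ((itv x h `&` [set y | (m + 2 * s < b y)%R]) `|`
    (itv x h `&` [set y | (b y < m - 2 * s)%R])))).
  apply: lebesgue_measure_subset => y [yh /=]; rewrite lter_normr => /orP[] sy.
    by left; split => //=; lra.
  by right; split => //=; lra.
apply: le_trans; first exact: measureU2.
have -> : h / 24 = h / 48 + h / 48 by lra.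
rewrite EFinD; apply: leeD.
- apply: (level (J `&` [set y | b y < m + s]) 1); rewrite ?normr1//.
  + by apply: measurableI => //; exact: measurable_lt_cst.
  + by move=> x' y /= ? [_ /= ?]; lra.
- apply: (level (J `&` [set y | m <= b y]) (-1)); rewrite ?normrN1//.
  + by apply: measurableI => //; exact: measurable_cst_le.
  + by move=> x' y /= ? [_ /= ?]; lra.
Qed.

(** * The absolute constant *)

(** For [c >= 1] and [k >= 1] one has [c <= c ^+ k], which keeps the final constant independent of
    [k]. *)
Lemma le_exprn_root (R : realType) (c B : R) (k : nat) :
  1 <= c -> 0 <= B -> (0 < k)%N -> c * B <= (c * B `^ (k%:R^-1)) ^+ k.
Proof.
move=> c1 B0 k0; have k_neq0 : k%:R != 0 :> R by rewrite pnatr_eq0 -lt0n.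
have pk : (B `^ (k%:R^-1)) ^+ k = B.
  by rewrite -powR_mulrn ?powR_ge0// -powRrM mulVf// powRr1.
by rewrite exprMn pk; apply: ler_wpM2r => //; exact: ler_eXnr.
Qed.

Theorem theorem2p3 (R : realType) :
  exists c : R, 0 < c /\
    forall (b : R -> R) (B : R) (k : nat),
      locally_integrable setT b -> 0 <= B -> (0 < k)%N ->
      (forall (t : R) (f : R -> R), 0 < t -> measurable_fun setT f ->
         (lebesgue_measure [set x : R | (t < `|commutator b k f x|)%R]
          <= \int[@lebesgue_measure R]_x (phi k (B * `|f x| / t))%:E)%E) ->
      in_BMO b /\ (bmo_norm b <= (c * B `^ (k%:R^-1))%:E)%E.
Proof.
(* The factor 64 is [32 * 2], from the threshold [2 * s], and [s] will be [1152] times the [k]-th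
   root of [B]. *)
exists (64 * 1152); split=> [|b B k lb B0 k0 weak]; first by lra.
have [mb _ _] := lb.
have bmo s : 0 < s -> 1152 * B <= s ^+ k -> (bmo_norm b <= (64 * s)%:E)%E.
  move=> s0 Bs.
  have osc := commutator_weak_type_oscillation _ _ _ _ _ mb B0 s0 Bs weak.
  have osc' (p : R * R) : exists m, 0 < p.2 ->
      (mu (itv p.1 p.2 `&` [set y | (2 * s < `|b y - m|)%R]) <= (p.2 / 24)%:E)%E.
    have [h0|h0] := ltP 0 p.2; last by exists 0.
    by have [m mw] := osc p.1 p.2 h0; exists m.
  have [m mw] := choice osc'.
  have -> : 64 * s = 32 * (2 * s) by ring.
  apply: (bmo_norm_le _ _ (fun x h => m (x, h))) => //; first lra.
  by move=> x h; exact: (mw (x, h)).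
suff bmoB : (bmo_norm b <= (64 * 1152 * B `^ (k%:R^-1))%:E)%E.
  by split => //; split => //; exact: le_lt_trans bmoB (ltry _).
have [B_gt0|] := ltP 0 B; last first.
  move=> B_le0; have B_0 : B = 0 by lra.
  rewrite B_0 powR0 ?mulr0; last by rewrite invr_eq0 pnatr_eq0 -lt0n.
  (* For [B = 0] every positive [s] is admissible in [bmo], so the norm is below every [e > 0]. *)
  apply/lee_addgt0Pr => e e0; rewrite add0e.
  have -> : e = 64 * (e / 64) by lra.
  have e640 : 0 < e / 64 by lra.
  apply: bmo => //; apply: le_trans (ltW (exprn_gt0 k e640)); lra.
rewrite -mulrA; apply: bmo.
  by have := powR_gt0 (k%:R^-1) B_gt0; lra.
by apply: le_exprn_root; [lra| | ].
Qed.
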